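(* Let $G$ be a connected graph on $n$ vertices whose edge weights are $s\times s$ positive definite matrices, with Laplacian $L$ and resistance matrix $R$. Let $X=(L+\frac1n J\otimes I_s)^{-1}$ with $s\times s$ blocks $X_{i,j}$, let $\bar X$ be the block diagonal matrix with diagonal blocks $X_{1,1},\dots,X_{n,n}$, and let $\tau$ be the $ns\times s$ matrix whose $i$-th $s\times s$ block is $\tau_i=2I_s-\sum_{j\sim i}W_{i,j}^{-1}R_{j,i}$. Then $$L\bar X(\mathbf{1}\otimes I_s)+\tfrac{2}{n}(\mathbf{1}\otimes I_s)=\tau.$$
   Context: $G$ is a simple connected graph with vertex set $\{1,\dots,n\}$; each edge $\{i,j\}$ carries a weight $W_{i,j}=W_{j,i}$, a real $s\times s$ positive definite matrix; $j\sim i$ means adjacency. The Laplacian $L$ is the $ns\times ns$ block matrix with $(i,i)$ block $\sum_{j\sim i}W_{i,j}^{-1}$, $(i,j)$ block ($i\ne j$) equal to $-W_{i,j}^{-1}$ if $i\sim j$ and $0$ otherwise. $J$ is the $n\times n$ all-ones matrix, $\mathbf{1}$ the all-ones column vector of length $n$, $I_s$ the identity, $\otimes$ the Kronecker product. Writing $K_{i,j}$ for the $s\times s$ blocks of the Moore--Penrose inverse $L^\dagger$, the resistance matrix $R$ is the $ns\times ns$ block matrix with blocks $R_{i,j}=K_{i,i}+K_{j,j}-2K_{i,j}$. *)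

(* Defs.v *)
From mathcomp Require Import all_boot all_order all_algebra.
From mathcomp Require Export mxtens.

Set Implicit Arguments.
Unset Strict Implicit.
Unset Printing Implicit Defensive.

Import Order.TTheory GRing.Theory Num.Theory.
Local Open Scope ring_scope.

Definition connected_graph (T : finType) (e : rel T) : Prop :=
  forall x y : T, connect e x y.

Definition posdefmx (R : realFieldType) (s : nat) (A : 'M[R]_s) : Prop :=
  A^T = A /\ forall x : 'cV[R]_s, x != 0 -> 0 < (x^T *m A *m x) 0 0.

(* Block matrices use the row/column indexing of the Kronecker product [*t]:
   entry (a, b) of block (i, j) sits at row [mxtens_index (i, a)] and column
   [mxtens_index (j, b)]. *)
Definition of_blocks (R : Type) (m n s : nat) (B : 'I_m -> 'I_n -> 'M[R]_s) :
    'M[R]_(m * s, n * s) :=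
  \matrix_(k, l) B (mxtens_unindex k).1 (mxtens_unindex l).1
                   (mxtens_unindex k).2 (mxtens_unindex l).2.

Definition block (R : Type) (m n s : nat) (A : 'M[R]_(m * s, n * s))
    (i : 'I_m) (j : 'I_n) : 'M[R]_s :=
  \matrix_(a, b) A (mxtens_index (i, a)) (mxtens_index (j, b)).

Lemma block_of_blocks (R : Type) (m n s : nat) (B : 'I_m -> 'I_n -> 'M[R]_s)
    (i : 'I_m) (j : 'I_n) : block (of_blocks B) i j = B i j.
Proof. by apply/matrixP=> a b; rewrite !mxE !mxtens_indexK. Qed.

Lemma of_blocksK (R : Type) (m n s : nat) (A : 'M[R]_(m * s, n * s)) :
  of_blocks (block A) = A.
Proof.
apply/matrixP=> k l.
case: (mxtens_indexP k) => i a; case: (mxtens_indexP l) => j b.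
by rewrite !mxE !mxtens_indexK.
Qed.

Section MoorePenrose.
Variable R : realFieldType.

Definition moore_penrose (m n : nat) (A : 'M[R]_(m, n)) : pred 'M[R]_(n, m) :=
  [pred B | [&& A *m B *m A == A, B *m A *m B == B,
                (A *m B)^T == A *m B & (B *m A)^T == B *m A]].

Lemma gram_unit (m n : nat) (A : 'M[R]_(m, n)) :
  row_free A -> A *m A^T \in unitmx.
Proof.
move=> fA; rewrite -row_free_unit -kermx_eq0; apply/eqP/row_matrixP => i.
rewrite row0; set u := row i _.
have uA : u *m (A *m A^T) = 0 by rewrite -row_mul mulmx_ker row0.
have uA0 : u *m A = 0.
  have : (u *m A) *m (u *m A)^T = 0.
    by rewrite trmx_mul -mulmxA [A *m _]mulmxA mulmxA mulmxA -[_ *m A *m _]mulmxA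
               uA mul0mx.
  move/matrixP/(_ 0 0); rewrite !mxE => /eqP.
  under eq_bigr do rewrite [X in _ * X]mxE -expr2.
  rewrite psumr_eq0 => [/allP sq0|j _]; last exact: sqr_ge0.
  apply/rowP=> j; rewrite [RHS]mxE; apply/eqP.
  by rewrite -sqrf_eq0; exact: sq0 (mem_index_enum j).
by apply: (row_free_inj fA); rewrite uA0 mul0mx.
Qed.

Lemma moore_penrose_exists (m n : nat) (A : 'M[R]_(m, n)) :
  exists B, moore_penrose A B.
Proof.
have: row_free (row_base A) by exact: row_base_free.
have: row_free (col_base A)^T by rewrite /row_free mxrank_tr; exact: col_base_full.
have := mulmx_base A.
move: (\rank A) (col_base A) (row_base A) => r C F eA /gram_unit uC /gram_unit uF.
rewrite trmxK in uC.
pose P := F^T *m invmx (F *m F^T); pose Q := invmx (C^T *m C) *m C^T.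
have FP : F *m P = 1%:M by rewrite /P mulmxA mulmxV.
have QC : Q *m C = 1%:M by rewrite /Q -mulmxA mulVmx.
have eAB : A *m (P *m Q) = C *m Q.
  by rewrite -eA -mulmxA [F *m _]mulmxA FP mul1mx.
have eBA : (P *m Q) *m A = P *m F.
  by rewrite -eA -mulmxA [Q *m _]mulmxA QC mul1mx.
exists (P *m Q); rewrite /moore_penrose /= eAB eBA; apply/and4P; split; apply/eqP.
- by rewrite -eA -mulmxA [Q *m _]mulmxA QC mul1mx.
- by rewrite -mulmxA [F *m _]mulmxA FP mul1mx.
- by rewrite /Q !(trmx_mul, trmx_inv, trmxK) mulmxA.
- by rewrite /P !(trmx_mul, trmx_inv, trmxK) mulmxA.
Qed.

Definition mpinvmx (m n : nat) (A : 'M[R]_(m, n)) : 'M[R]_(n, m) :=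
  xchoose (moore_penrose_exists A).

Lemma mpinvmxP (m n : nat) (A : 'M[R]_(m, n)) : moore_penrose A (mpinvmx A).
Proof. exact: xchooseP. Qed.

Lemma moore_penrose_uniq (m n : nat) (A : 'M[R]_(m, n)) (B : 'M[R]_(n, m)) :
  moore_penrose A B -> B = mpinvmx A.
Proof.
move: (mpinvmxP A); move: (mpinvmx A) => D.
move=> /and4P[/eqP d1 /eqP d2 /eqP d3 /eqP d4].
move=> /and4P[/eqP b1 /eqP b2 /eqP b3 /eqP b4].
have AB : A *m B = A *m D.
  by rewrite -b3 -{1}d1 -mulmxA trmx_mul b3 d3 mulmxA b1.
have BA : B *m A = D *m A.
  by rewrite -b4 -{1}d1 -[_ *m A]mulmxA mulmxA trmx_mul b4 d4 -!mulmxA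
             [A *m (B *m A)]mulmxA b1.
by rewrite -b2 BA -mulmxA AB mulmxA d2.
Qed.

End MoorePenrose.

Section ResistanceMatrix.
Variables (R : realFieldType) (n s : nat).
Variables (adj : rel 'I_n) (W : 'I_n -> 'I_n -> 'M[R]_s).

Definition laplacian : 'M[R]_(n * s) :=
  of_blocks (fun i j =>
    if i == j then \sum_(k | adj i k) invmx (W i k)
    else if adj i j then - invmx (W i j) else 0).

Definition resistance : 'M[R]_(n * s) :=
  let K := block (mpinvmx laplacian) in
  of_blocks (fun i j => K i i + K j j - 2 *: K i j).

Definition Xmx : 'M[R]_(n * s) :=
  invmx (laplacian + n%:R^-1 *: ((const_mx 1 : 'M[R]_n) *t (1%:M : 'M[R]_s))).

Definition Xbar : 'M[R]_(n * s) :=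
  of_blocks (fun i j => if i == j then block Xmx i i else 0).

(* The n x 1 array of blocks tau_i; its column count [1 * s] is the one of
   [const_mx 1 *t 1%:M] with [const_mx 1 : 'cV_n], so that no cast is needed. *)
Definition tau : 'M[R]_(n * s, 1 * s) :=
  of_blocks (fun (i : 'I_n) (_ : 'I_1) =>
    2 *: 1%:M - \sum_(j | adj i j) invmx (W i j) *m block resistance j i).

End ResistanceMatrix.

(* Main.v *)
(** Write P = (1/n) J (x) I_s. Since LP = PL = 0 and P is a symmetric idempotent
    whose image is the kernel of L (the quadratic form of L is a sum over edges
    of positive definite forms in the differences of vertex values), L + P is
    invertible, and its inverse X satisfies PX = XP = P, LX = XL = 1 - P and
    L^+ = X - P. The contributions of P cancel in the resistance blocks, so
    R_ij = X_ii + X_jj - 2 X_ij, and substituting the (i, i) block of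
    LX = 1 - P into tau_i gives the identity. *)
Require Import Defs.
From mathcomp Require Import all_boot all_order all_algebra.
From mathcomp Require Import ring.
Import Order.TTheory GRing.Theory Num.Theory.

Set Implicit Arguments.
Unset Strict Implicit.
Unset Printing Implicit Defensive.

Local Open Scope ring_scope.

(** * Block calculus for matrices indexed by pairs *)

Section Blocks.
Variable R : comPzRingType.

Lemma block_inj (m n s : nat) (A B : 'M[R]_(m * s, n * s)) :
  (forall i j, block A i j = block B i j) -> A = B.
Proof.
move=> eAB; apply/matrixP=> k l.
case: (mxtens_indexP k) => i a; case: (mxtens_indexP l) => j b.
by have /matrixP/(_ a b) := eAB i j; rewrite !mxE.
Qed.

Lemma blockD (m n s : nat) (A B : 'M[R]_(m * s, n * s)) i j :
  block (A + B) i j = block A i j + block B i j.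
Proof. by apply/matrixP=> a b; rewrite !mxE. Qed.

Lemma blockB (m n s : nat) (A B : 'M[R]_(m * s, n * s)) i j :
  block (A - B) i j = block A i j - block B i j.
Proof. by apply/matrixP=> a b; rewrite !mxE. Qed.

Lemma blockZ (m n s : nat) c (A : 'M[R]_(m * s, n * s)) i j :
  block (c *: A) i j = c *: block A i j.
Proof. by apply/matrixP=> a b; rewrite !mxE. Qed.

Lemma block_tr (m n s : nat) (A : 'M[R]_(m * s, n * s)) i j :
  block A^T i j = (block A j i)^T.
Proof. by apply/matrixP=> a b; rewrite !mxE. Qed.

Lemma block1 (n s : nat) (i j : 'I_n) :
  block (1%:M : 'M[R]_(n * s)) i j = (i == j)%:R%:M.
Proof.
apply/matrixP=> a b; rewrite !mxE (can_eq (@mxtens_indexK _ _)) xpair_eqE.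
by case: eqP; case: eqP.
Qed.

Lemma block_tens (m n s : nat) (A : 'M[R]_(m, n)) (B : 'M[R]_s) i j :
  block (A *t B) i j = A i j *: B.
Proof. by apply/matrixP=> a b; rewrite !mxE !mxtens_indexK. Qed.

Lemma sum_mxtens_index (n s : nat) (F : 'I_(n * s) -> R) :
  \sum_k F k = \sum_i \sum_a F (mxtens_index (i, a)).
Proof.
rewrite pair_big (reindex (@mxtens_index n s)) /=; last first.
  by exists (@mxtens_unindex n s) => ? _; rewrite (mxtens_indexK, mxtens_unindexK).
by apply: eq_bigr => -[].
Qed.

Lemma block_mul (m n p s : nat) (A : 'M[R]_(m * s, n * s))
    (B : 'M[R]_(n * s, p * s)) i j :
  block (A *m B) i j = \sum_k block A i k *m block B k j.
Proof.
apply/matrixP=> a b; rewrite !mxE summxE sum_mxtens_index.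
by apply: eq_bigr => k _; rewrite !mxE; apply: eq_bigr => c _; rewrite !mxE.
Qed.

(** [block] cuts the column index as well, into pieces of size [s]; a single column needs its own
    splitting, along the rows only. *)
Definition colblock (n s : nat) (y : 'cV[R]_(n * s)) (i : 'I_n) : 'cV[R]_s :=
  \col_a y (mxtens_index (i, a)) 0.

Lemma colblock_inj (n s : nat) (y z : 'cV[R]_(n * s)) :
  colblock y =1 colblock z -> y = z.
Proof.
move=> eyz; apply/colP=> k; case: (mxtens_indexP k) => i a.
by have /colP/(_ a) := eyz i; rewrite !mxE.
Qed.

Lemma colblock_mul (m n s : nat) (A : 'M[R]_(m * s, n * s)) y i :
  colblock (A *m y) i = \sum_k block A i k *m colblock y k.
Proof.
apply/colP=> a; rewrite !mxE summxE sum_mxtens_index.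
by apply: eq_bigr => k _; rewrite !mxE; apply: eq_bigr => c _; rewrite !mxE.
Qed.

Lemma colblock_dot (n s : nat) (y z : 'cV[R]_(n * s)) :
  y^T *m z = \sum_i (colblock y i)^T *m colblock z i.
Proof.
apply/matrixP=> a b; rewrite !ord1 !mxE summxE sum_mxtens_index.
by apply: eq_bigr => k _; rewrite !mxE; apply: eq_bigr => c _; rewrite !mxE.
Qed.

End Blocks.

(** * Positive definite weights and their inverses *)

Section PosDef.
Variables (R : realFieldType) (s : nat).
Implicit Types (A : 'M[R]_s) (x : 'cV[R]_s).

Lemma posdefmx_unit A : posdefmx A -> A \in unitmx.
Proof.
case=> symA posA; rewrite -row_free_unit -kermx_eq0.
apply/eqP/row_matrixP => i; rewrite row0; set u := row i _.
have uA : u *m A = 0 by rewrite -row_mul mulmx_ker row0.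
apply/eqP/negPn/negP => u0; have := posA u^T.
by rewrite trmxK uA mul0mx mxE ltxx trmx_eq0 u0 => /(_ isT).
Qed.

(** The form of the inverse at [x] is the form of [A] at [invmx A *m x], which is nonzero when [x]
    is. *)
Lemma posdefmx_inv A : posdefmx A -> posdefmx (invmx A).
Proof.
move=> pA; have uA := posdefmx_unit pA; case: pA => symA posA.
have symV : (invmx A)^T = invmx A by rewrite trmx_inv symA.
split=> // x x0; have := posA (invmx A *m x).
rewrite trmx_mul symV -(mulmxA _ (invmx A)) mulVmx // mulmx1 mulmxA.
apply; apply: contraNneq x0 => Vx0.
by rewrite -[x]mul1mx -(mulmxV uA) -mulmxA Vx0 mulmx0.
Qed.

Lemma posdefmx_ge0 A x : posdefmx A -> 0 <= (x^T *m A *m x) 0 0.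
Proof.
case=> _ posA; have [->|/posA/ltW//] := eqVneq x 0.
by rewrite mulmx0 mxE.
Qed.

Lemma posdefmx_eq0 A x : posdefmx A -> (x^T *m A *m x) 0 0 = 0 -> x = 0.
Proof.
case=> _ posA q0; apply/eqP/negPn/negP => /posA.
by rewrite q0 ltxx.
Qed.

End PosDef.

(** * The Laplacian, the averaging projection and the kernel of the Laplacian *)

Section Laplacian.
Variables (R : realFieldType) (n s : nat).
Variables (adj : rel 'I_n) (W : 'I_n -> 'I_n -> 'M[R]_s).
Hypothesis n_gt0 : (0 < n)%N.
Hypotheses (adj_sym : symmetric adj) (adj_irr : irreflexive adj).
Hypothesis adj_conn : connected_graph adj.
Hypothesis W_sym : forall i j, adj i j -> W i j = W j i.
Hypothesis W_posdef : forall i j, adj i j -> posdefmx (W i j).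

Local Notation L := (laplacian adj W).
Local Notation V i j := (invmx (W i j)).
Local Notation P := (n%:R^-1 *: ((const_mx 1 : 'M[R]_n) *t (1%:M : 'M[R]_s))).
Local Notation X := (Xmx adj W).

Lemma natr_neq0 : n%:R != 0 :> R.
Proof. by rewrite pnatr_eq0 -lt0n. Qed.

Lemma block_avg i j : block P i j = n%:R^-1%:M.
Proof. by rewrite blockZ block_tens mxE scale1r scalemx1. Qed.

Lemma block_laplacianE i j :
  block L i j = if i == j then \sum_(k | adj i k) V i k
                else if adj i j then - V i j else 0.
Proof. by rewrite block_of_blocks. Qed.

(** The diagonal block is the sum of the edge blocks, so each neighbour contributes a difference;
    irreflexivity of [adj] removes the term [k = i]. The width [p] is free, so that this serves both
    block columns and column vectors. *)
Lemma laplacian_row p (Y : 'I_n -> 'M[R]_(s, p)) i :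
  \sum_k block L i k *m Y k = \sum_(k | adj i k) V i k *m (Y i - Y k).
Proof.
rewrite (bigD1 i) //= block_laplacianE eqxx mulmx_suml.
under [RHS]eq_bigr do rewrite mulmxBr.
rewrite sumrB -sumrN; congr (_ + _).
rewrite [LHS]big_mkcond [RHS]big_mkcond; apply: eq_bigr => k _ /=.
rewrite block_laplacianE eq_sym; have [->|_] := eqVneq i k.
  by rewrite adj_irr.
by case: ifP => _; rewrite ?mulNmx ?mul0mx.
Qed.

Lemma laplacian_tr : L^T = L.
Proof.
apply: block_inj => i j; rewrite block_tr !block_laplacianE eq_sym adj_sym.
case: eqVneq => [->|_].
  rewrite raddf_sum; apply: eq_bigr => k ak /=.
  by rewrite trmx_inv; case: (W_posdef ak) => ->.
case: ifP => [aij|_]; last by rewrite trmx0.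
by rewrite linearN /= trmx_inv -(W_sym aij); case: (W_posdef aij) => ->.
Qed.

Lemma laplacian_avg : L *m P = 0.
Proof.
apply: block_inj => i j; rewrite block_mul laplacian_row big1; last first.
  by move=> k _; rewrite !block_avg subrr mulmx0.
by apply/matrixP=> a b; rewrite !mxE.
Qed.

Lemma avg_tr : P^T = P.
Proof. by apply: block_inj => i j; rewrite block_tr !block_avg tr_scalar_mx. Qed.

Lemma avg_laplacian : P *m L = 0.
Proof. by rewrite -laplacian_tr -avg_tr -trmx_mul laplacian_avg trmx0. Qed.

Lemma avg_idem : P *m P = P.
Proof.
apply: block_inj => i j; rewrite block_mul.
under eq_bigr do rewrite !block_avg -scalar_mxM.
rewrite sumr_const card_ord block_avg -scaler_nat scale_scalar_mx.
by rewrite mulrA mulfV ?natr_neq0 // mul1r.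
Qed.

(** The factor 2 is there because the double sum meets each edge in both orientations. *)
Lemma laplacian_form (y : 'cV[R]_(n * s)) :
  2 * (y^T *m L *m y) 0 0 =
  \sum_i \sum_(j | adj i j)
    ((colblock y i - colblock y j)^T *m V i j *m
      (colblock y i - colblock y j)) 0 0.
Proof.
set c := colblock y.
have yLy : (y^T *m L *m y) 0 0 =
    \sum_i \sum_(j | adj i j) ((c i)^T *m V i j *m (c i - c j)) 0 0.
  rewrite -mulmxA colblock_dot summxE; apply: eq_bigr => i _.
  rewrite colblock_mul laplacian_row mulmx_sumr summxE.
  by apply: eq_bigr => j _; rewrite mulmxA.
rewrite mulr2n mulrDl !mul1r {1}yLy yLy.
(* In the second copy of the sum the two ends of each edge are swapped; since the weights are
   symmetric, the two copies add up to the form in the difference. *)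
rewrite [X in _ + X](exchange_big_dep predT) //= -big_split /=.
apply: eq_bigr => i _.
under [X in _ + X]eq_bigl do rewrite adj_sym.
rewrite -big_split /=; apply: eq_bigr => j aij.
rewrite -(W_sym aij) -[c j - c i]opprB mulmxN.
have -> : (c i - c j)^T = (c i)^T - (c j)^T by rewrite linearB.
rewrite (mulmxBl (c i)^T) mulmxBl.
by rewrite !mxE.
Qed.

(** A vanishing sum of nonnegative terms has only zero terms, so the ends of each edge carry equal
    values; a path carries this equality to any two vertices. *)
Lemma laplacian_form_eq0 (y : 'cV[R]_(n * s)) :
  (y^T *m L *m y) 0 0 = 0 -> forall i j, colblock y i = colblock y j.
Proof.
move=> q0; have := laplacian_form y; rewrite q0 mulr0 => /esym/eqP.
have ge0 i j : adj i j ->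
    0 <= ((colblock y i - colblock y j)^T *m V i j *m
           (colblock y i - colblock y j)) 0 0.
  by move=> aij; exact/posdefmx_ge0/posdefmx_inv/W_posdef.
rewrite psumr_eq0 => [/allP all0|i _]; last by apply: sumr_ge0 => j; exact: ge0.
have step i j : adj i j -> colblock y i = colblock y j.
  move=> aij; have := all0 i (mem_index_enum i).
  rewrite psumr_eq0 => [/allP/(_ j (mem_index_enum j))|]; last exact: ge0.
  rewrite aij /= => /eqP; move/(posdefmx_eq0 (posdefmx_inv (W_posdef aij))).
  by move/subr0_eq.
move=> i j; have /connectP[p + ->] := adj_conn i j.
elim: p i => [//|k p IHp i] /= /andP[/step-> pkp]; exact: IHp.
Qed.

Lemma laplacian_avg_unit : L + P \in unitmx.
Proof.
rewrite -row_free_unit -kermx_eq0; apply/eqP/row_matrixP => i.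
rewrite row0; set u := row i _.
have uM : u *m (L + P) = 0 by rewrite -row_mul mulmx_ker row0.
(* Multiplying [u *m (L + P) = 0] by [P] on the right kills the [L] part and keeps [u *m P]. *)
have uP : u *m P = 0.
  have := congr1 (mulmx^~ P) uM.
  by rewrite -mulmxA mulmxDl laplacian_avg add0r avg_idem mul0mx.
have uL : u *m L = 0 by move: uM; rewrite mulmxDr uP addr0.
pose y := u^T; suff y0 : y = 0 by rewrite -[u]trmxK -/y y0 trmx0.
have cst : forall i j, colblock y i = colblock y j.
  by apply: laplacian_form_eq0; rewrite trmxK uL mul0mx mxE.
have Py : P *m y = 0 by rewrite -avg_tr -trmx_mul uP trmx0.
apply: colblock_inj => k; have := congr1 (fun z => colblock z k) Py.
rewrite /= colblock_mul.
(* As all blocks of [y] agree, averaging returns the [k]-th block itself, and the average is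
   zero. *)
under eq_bigr do rewrite block_avg mul_scalar_mx (cst _ k).
rewrite sumr_const card_ord -scaler_nat scalerA mulfV ?natr_neq0 // scale1r.
by move->; apply/colP=> a; rewrite !mxE.
Qed.

(** * The inverse [X], the pseudoinverse of [L] and the resistance blocks *)

Lemma avg_Xmx : P *m X = P.
Proof.
rewrite -[RHS]mulmx1 -(mulmxV laplacian_avg_unit) mulmxA mulmxDr.
by rewrite avg_laplacian add0r avg_idem.
Qed.

Lemma Xmx_avg : X *m P = P.
Proof.
rewrite -[RHS]mul1mx -(mulVmx laplacian_avg_unit) -mulmxA mulmxDl.
by rewrite laplacian_avg add0r avg_idem.
Qed.

Lemma laplacian_Xmx : L *m X = 1%:M - P.
Proof.
by rewrite -(mulmxV laplacian_avg_unit) mulmxDl -/X avg_Xmx addrK.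
Qed.

Lemma Xmx_laplacian : X *m L = 1%:M - P.
Proof.
by rewrite -(mulVmx laplacian_avg_unit) mulmxDr -/X Xmx_avg addrK.
Qed.

(** By uniqueness it suffices to check the Penrose conditions; both products of [L] with [X - P]
    equal the symmetric matrix [1%:M - P]. *)
Lemma mpinvmx_laplacian : mpinvmx L = X - P.
Proof.
have LK : L *m (X - P) = 1%:M - P.
  by rewrite mulmxBr laplacian_avg subr0 laplacian_Xmx.
have KL : (X - P) *m L = 1%:M - P.
  by rewrite mulmxBl avg_laplacian subr0 Xmx_laplacian.
apply/esym/moore_penrose_uniq; rewrite /moore_penrose /= LK KL.
have Q_tr : (1%:M - P)^T = 1%:M - P by rewrite linearB /= avg_tr trmx1.
rewrite !Q_tr eqxx !andbT; apply/andP; split; apply/eqP.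
  by rewrite mulmxBl mul1mx avg_laplacian subr0.
by rewrite mulmxBl mul1mx mulmxBr avg_Xmx avg_idem subrr subr0.
Qed.

(** All blocks of [P] are equal, and they enter with coefficients 1, 1 and -2. *)
Lemma block_resistance i j :
  block (resistance adj W) i j = block X i i + block X j j - 2 *: block X i j.
Proof.
rewrite block_of_blocks mpinvmx_laplacian !blockB !block_avg.
by apply/matrixP=> a b; rewrite !mxE; ring.
Qed.

End Laplacian.

(** * Comparison of the two sides block by block *)

Theorem theorem3p3 (R : realFieldType) (n s : nat)
    (n_gt0 : (0 < n)%N) (s_gt0 : (0 < s)%N)
    (adj : rel 'I_n) (W : 'I_n -> 'I_n -> 'M[R]_s)
    (adj_sym : symmetric adj) (adj_irr : irreflexive adj)
    (adj_conn : connected_graph adj)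
    (W_sym : forall i j : 'I_n, adj i j -> W i j = W j i)
    (W_posdef : forall i j : 'I_n, adj i j -> posdefmx (W i j)) :
  laplacian adj W *m Xbar adj W *m ((const_mx 1 : 'cV[R]_n) *t (1%:M : 'M[R]_s))
    + (2 / n%:R) *: ((const_mx 1 : 'cV[R]_n) *t (1%:M : 'M[R]_s))
  = tau adj W.
Proof.
apply: block_inj => i j.
rewrite blockD blockZ block_of_blocks block_tens mxE scale1r -mulmxA block_mul.
have XbarU k : block (Xbar adj W *m ((const_mx 1 : 'cV[R]_n) *t 1%:M)) k j =
    block (Xmx adj W) k k.
  rewrite block_mul (bigD1 k) //= big1 => [|l lk].
    by rewrite block_of_blocks eqxx block_tens mxE scale1r mulmx1 addr0.
  by rewrite block_of_blocks eq_sym (negPf lk) mul0mx.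
under eq_bigr do rewrite XbarU.
rewrite laplacian_row //.
(* This is the [(i, i)] block of [L *m X = 1%:M - P], written with differences along the edges at
   [i]. *)
have LXii : \sum_(k | adj i k) invmx (W i k) *m
    (block (Xmx adj W) i i - block (Xmx adj W) k i) = 1%:M - n%:R^-1%:M.
  rewrite -(laplacian_row W adj_irr (fun k => block (Xmx adj W) k i)).
  rewrite -block_mul laplacian_Xmx //.
  by rewrite blockB block1 eqxx block_avg.
(* Split $X_{kk} + X_{ii} - 2X_{ki}$ as $2(X_{ii} - X_{ki}) - (X_{ii} - X_{kk})$: the first part is
   summed by [LXii], the second gives the row of $L\bar X(\mathbf{1}\otimes I_s)$. *)
have -> : \sum_(k | adj i k) invmx (W i k) *m block (resistance adj W) k i =
    2 *: (1%:M - n%:R^-1%:M) -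
    \sum_(k | adj i k) invmx (W i k) *m
      (block (Xmx adj W) i i - block (Xmx adj W) k k).
  rewrite -LXii scaler_sumr -sumrB; apply: eq_bigr => k _.
  rewrite block_resistance // scalemxAr -mulmxBr; congr (_ *m _).
  by apply/matrixP=> a b; rewrite !mxE; ring.
rewrite scalerBr !scale_scalar_mx !mulr1.
by rewrite opprB addrCA opprB; congr (_ + _); rewrite addrC subrK.
Qed.
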